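(* Let $V$ be a finite set and $C=(c_{vw})_{v,w\in V}$ a real symmetric matrix whose off-diagonal entries satisfy $c_{xz}\ge\min\{c_{xy},c_{yz}\}$ for all pairwise distinct $x,y,z\in V$. Let $x,y\in V$ with $x\neq y$. Then the following are equivalent: (a) $c_{xy}$ is maximal among the off-diagonal entries in its row and in its column, and $c_{xx}=c_{yy}$; (b) $e_x-e_y$ is an eigenvector of $C$ with eigenvalue $c_{xx}-c_{xy}$.
   Context: $e_v$ ($v\in V$) denotes the standard basis vectors of $\mathbb{R}^V$. *)

(* Defs.v *)
From HB Require Import structures.
From mathcomp Require Import all_boot all_order all_algebra.
From mathcomp Require Import reals.

Set Implicit Arguments.
Unset Strict Implicit.
Unset Printing Implicit Defensive.

Import Order.TTheory GRing.Theory Num.Theory.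
Local Open Scope ring_scope.

(* Matrices and vectors indexed by a finite type V are the library's ones of
   dimension #|V|, the index v : V being encoded as enum_rank v : 'I_#|V|. *)
Definition fam_mx (R : Type) (V : finType) (c : V -> V -> R) : 'M[R]_#|V| :=
  \matrix_(i, j) c (enum_val i) (enum_val j).

Definition std_vec (R : nzRingType) (V : finType) (v : V) : 'cV[R]_#|V| :=
  delta_mx (enum_rank v) 0.

(* Column eigenvectors: the library's eigenspace acts on row vectors, by
   u *m A. *)
Definition eigenvector (R : fieldType) (n : nat) (A : 'M[R]_n) (a : R)
    (u : 'cV[R]_n) : Prop :=
  u != 0 /\ A *m u = a *: u.

Definition maximal_in_row (R : realType) (V : finType) (c : V -> V -> R)
    (x y : V) : Prop :=
  forall z : V, z != x -> c x z <= c x y.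

Definition maximal_in_column (R : realType) (V : finType) (c : V -> V -> R)
    (x y : V) : Prop :=
  forall z : V, z != y -> c z y <= c x y.

(* Main.v *)
(* Read coordinatewise, the eigenvector equation says that c x x = c y y and
   that c z x = c z y for every z outside {x, y}.  In every triangle x, y, z the
   minimum of c over the three edges is attained at least twice, so
   c z x = c z y <= c x y holds exactly when c x y is a largest edge. *)
Require Import Defs.
From HB Require Import structures.
From mathcomp Require Import all_boot all_order all_algebra.
From mathcomp Require Import reals.

Set Implicit Arguments.
Unset Strict Implicit.
Unset Printing Implicit Defensive.

Import Order.TTheory GRing.Theory Num.Theory.
Local Open Scope ring_scope.

Lemma fam_mx_std_vec (R : nzRingType) (V : finType) (c : V -> V -> R)
    (v w : V) (j : 'I_1) :
  (fam_mx c *m std_vec R w) (enum_rank v) j = c v w.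
Proof. by rewrite /std_vec (ord1 j) -colE !mxE !enum_rankK. Qed.

Lemma std_vecE (R : nzRingType) (V : finType) (v w : V) (j : 'I_1) :
  std_vec R w (enum_rank v) j = (v == w)%:R.
Proof. by rewrite mxE (ord1 j) eqxx andbT (inj_eq enum_rank_inj). Qed.

Lemma std_vec_sub_neq0 (R : nzRingType) (V : finType) (x y : V) :
  x != y -> std_vec R x - std_vec R y != 0.
Proof.
move=> xy; apply/eqP => /matrixP/(_ (enum_rank x) 0).
rewrite mxE [X in _ + X]mxE !std_vecE eqxx (negPf xy) subr0 mxE.
by move/eqP; rewrite oner_eq0.
Qed.

(** Every matrix index is [enum_rank] of some vertex, so the vector equation can be tested vertex by
    vertex; the nonvanishing condition comes for free from [x != y]. *)
Lemma eigenvector_std_vec_sub (R : fieldType) (V : finType)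
    (c : V -> V -> R) (a : R) (x y : V) :
  x != y ->
  eigenvector (fam_mx c) a (std_vec R x - std_vec R y) <->
  (forall v, c v x - c v y = a * ((v == x)%:R - (v == y)%:R)).
Proof.
move=> xy; set u := std_vec R x - std_vec R y.
have lhsE v j : (fam_mx c *m u) (enum_rank v) j = c v x - c v y.
  by rewrite mulmxBr mxE [X in _ + X]mxE !fam_mx_std_vec.
have rhsE v j : (a *: u) (enum_rank v) j = a * ((v == x)%:R - (v == y)%:R).
  by rewrite mxE [X in _ * X]mxE [X in _ + X]mxE !std_vecE.
split=> [[_ eig] v | E]; first by rewrite -(lhsE v 0) eig rhsE.
split; first exact: std_vec_sub_neq0.
by apply/matrixP => i j; rewrite -(enum_valK i) lhsE rhsE.
Qed.

Theorem theorem5 (R : realType) (V : finType) (c : V -> V -> R)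
  (c_sym : forall v w : V, c v w = c w v)
  (c_ultra : forall x y z : V, x != y -> y != z -> x != z ->
     Num.min (c x y) (c y z) <= c x z)
  (x y : V) (xy : x != y) :
  (maximal_in_row c x y /\ maximal_in_column c x y /\ c x x = c y y) <->
  eigenvector (fam_mx c) (c x x - c x y) (std_vec R x - std_vec R y).
Proof.
rewrite (eigenvector_std_vec_sub _ _ xy).
have yx : y != x by rewrite eq_sym.
split=> [[max_row [max_col diag]] v | E].
  have [->|vx] := eqVneq v x; first by rewrite (negPf xy) subr0 mulr1.
  have [->|vy] := eqVneq v y.
    by rewrite -diag (c_sym y x) sub0r mulrN1 opprB.
  rewrite subrr mulr0; apply/eqP; rewrite subr_eq0 eq_le.
  have vx_le : c v x <= c x y by rewrite c_sym max_row.
  have vy_le : c v y <= c x y by rewrite max_col.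
  (* The path from [v] to [y] through [x] gives [c v x <= c v y], since maximality makes [c v x] the
     minimum along it; the path from [v] to [x] through [y] gives the converse. *)
  have := c_ultra _ _ _ vx xy vy; rewrite (min_idPl vx_le) => ->.
  by have := c_ultra _ _ _ vy yx vx; rewrite (c_sym y x) (min_idPl vy_le).
have off v : v != x -> v != y -> c v x = c v y.
  move=> vx vy; apply/eqP; rewrite -subr_eq0 E.
  by rewrite (negPf vx) (negPf vy) subrr mulr0.
have le_xy v : v != x -> v != y -> c v y <= c x y.
  move=> vx vy; have xv : x != v by rewrite eq_sym.
  (* Here [v] is the middle vertex: both edges of the path from [x] to [y] have the value [c v y],
     which is therefore their minimum. *)
  by have := c_ultra _ _ _ xv vy xy; rewrite (c_sym x v) (off v) // minxx.
split=> [z zx|]; last split=> [z zy|].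
- by have [->//|zy] := eqVneq z y; rewrite c_sym off // le_xy.
- have [->|zx] := eqVneq z x; [exact: lexx | exact: le_xy].
(* Only coordinate [y] compares the two diagonal entries: it reads [c x y - c y y = c x y - c x x],
   whereas coordinate [x] is an identity. *)
have := E y; rewrite (negPf yx) eqxx sub0r mulrN1 opprB (c_sym y x).
by move/addrI/oppr_inj.
Qed.
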